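(* Let $\gamma>0$ and $\beta>0$, and let $f$ be the skew Student's $t$ density on $\mathbb{R}$ $$f(x)=\frac{\left(1+\frac{x}{\sqrt{\gamma+\beta+x^2}}\right)^{\gamma+\frac12}\left(1-\frac{x}{\sqrt{\gamma+\beta+x^2}}\right)^{\beta+\frac12}}{B(\gamma,\beta)\sqrt{\gamma+\beta}\,2^{\gamma+\beta-1}}.$$ For every $\alpha>0$, $\alpha\neq1$, such that $\alpha\left(\gamma+\frac12\right)-\frac12>0$ and $\alpha\left(\beta+\frac12\right)-\frac12>0$, the Rényi information of $f$ is $$\mathcal R_\alpha(f)=\frac{1}{1-\alpha}\log\left(\frac{4^{\alpha-1}\,B\left(\alpha\left(\gamma+\frac12\right)-\frac12,\ \alpha\left(\beta+\frac12\right)-\frac12\right)}{\left(\sqrt{\beta+\gamma}\right)^{\alpha-1}B^\alpha(\gamma,\beta)}\right).$$ Moreover, the Shannon entropy is $$\mathcal R_1(f)=-\log\left(\frac{4}{\sqrt{\gamma+\beta}\,B(\gamma,\beta)}\right)-\left(\beta+\frac12\right)\psi(\beta)-\left(\gamma+\frac12\right)\psi(\gamma)+(\beta+\gamma+1)\psi(\beta+\gamma),$$ and the Song measure is $$\mathcal S(f)=\left(\beta+\frac12\right)^2\dot\psi(\beta)+\left(\gamma+\frac12\right)^2\dot\psi(\gamma)-(\beta+\gamma+1)^2\dot\psi(\beta+\gamma).$$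
   Context: For a probability density $f$ on $\mathbb{R}$ and $\alpha>0$, $\alpha\neq1$, the Rényi information of order $\alpha$ is $\mathcal R_\alpha(f)=\frac{1}{1-\alpha}\log\int f^\alpha(x)\,dx$; the Shannon entropy is $\mathcal R_1(f)=\lim_{\alpha\to1}\mathcal R_\alpha(f)=-\int f(x)\log f(x)\,dx$; the Song measure is $$\mathcal S(f)=-2\,\frac{\partial}{\partial\alpha}\mathcal R_\alpha(f)\Big|_{\alpha=1}=\mathrm{Var}(\log f(X)),$$ where $X$ is a random variable with density $f$. $B(a,b)=\Gamma(a)\Gamma(b)/\Gamma(a+b)$ is the Beta function, $B^\alpha(a,b)=(B(a,b))^\alpha$, $\psi(x)=\Gamma'(x)/\Gamma(x)$ is the digamma function and $\dot\psi$ is its derivative. The density $f$ arises as the invariant density of the diffusion $dX_t=\frac{\sigma^2}{2}(\log f)'(X_t)\,dt+\sigma\,dW_t$ with constant $\sigma>0$. *)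

(* Defs.v *)
From HB Require Import structures.
From mathcomp Require Import all_boot all_order all_algebra.
From mathcomp Require Import all_classical all_reals all_analysis.
Set Implicit Arguments.
Unset Strict Implicit.
Unset Printing Implicit Defensive.
Import Order.TTheory GRing.Theory Num.Theory.
Import numFieldNormedType.Exports.
Local Open Scope classical_set_scope.
Local Open Scope ring_scope.

(* Euler's integral. The value is meant for 0 < a only: [fine] sends the
   divergent integrals at a <= 0 to 0. *)
Definition Gamma {R : realType} (a : R) : R :=
  \int[lebesgue_measure]_(t in `]0, +oo[) (t `^ (a - 1) * expR (- t)).

Definition Beta {R : realType} (a b : R) : R :=
  Gamma a * Gamma b / Gamma (a + b).

Definition digamma {R : realType} (x : R) : R := derive1 Gamma x / Gamma x.

Definition trigamma {R : realType} (x : R) : R := derive1 digamma x.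

Definition prob_density {R : realType} (f : R -> R) : Prop :=
  [/\ measurable_fun setT f,
      forall x, 0 <= f x &
      (\int[lebesgue_measure]_x (f x)%:E = 1)%E].

Definition has_density {R : realType} d (T : measurableType d)
    (P : probability T R) (X : {RV P >-> R}) (f : R -> R) : Prop :=
  forall A : set R, measurable A ->
    distribution P X A = (\int[lebesgue_measure]_(x in A) (f x)%:E)%E.

(* Entropies are extended reals, so that an equation [_ = r%:E] also says that
   the underlying integrals converge: a divergent integral of f^alpha gives an
   infinite [lne], and a non-integrable f log f an infinite integral. *)
Definition shannon {R : realType} (f : R -> R) : \bar R :=
  (- \int[lebesgue_measure]_x (f x * ln (f x))%:E)%E.

Definition renyi {R : realType} (alpha : R) (f : R -> R) : \bar R :=
  if alpha == 1 then shannon f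
  else ((1 - alpha)^-1%:E
        * lne (\int[lebesgue_measure]_x (f x `^ alpha)%:E))%E.

Definition renyi_fin {R : realType} (f : R -> R) (alpha : R) : R :=
  fine (renyi alpha f).

Definition song {R : realType} (f : R -> R) : R := - 2 * derive1 (renyi_fin f) 1.

Definition skew_t {R : realType} (gamma beta : R) (x : R) : R :=
  (1 + x / Num.sqrt (gamma + beta + x ^+ 2)) `^ (gamma + 2^-1)
  * (1 - x / Num.sqrt (gamma + beta + x ^+ 2)) `^ (beta + 2^-1)
  / (Beta gamma beta * Num.sqrt (gamma + beta) * 2 `^ (gamma + beta - 1)).

(* Main.v *)
(* With t ranging over R and x = sqrt(gamma + beta) sinh(t / 2), the integral of
   f^alpha becomes that of exp(a t) / (1 + exp t)^(a + b), which is Beta a b.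
   The latter follows from Gamma a = int exp(a s - exp s) ds by Tonelli and
   translations only.  Both s |-> int f^s and Gamma are moment generating
   functions int h exp(s phi); these may be differentiated under the integral,
   which gives the integrals of f ln f and f (ln f)^2 as derivatives at s = 1 of
   int f^s = exp(L s).  Since L 1 = 0, one finds R_1 = - L' 1,
   Var(ln f(X)) = L'' 1, and R_alpha = L alpha / (1 - alpha) has derivative
   - L'' 1 / 2 at 1 by a second-order expansion of L. *)
Require Import Defs.
From HB Require Import structures.
From mathcomp Require Import all_boot all_order all_algebra.
From mathcomp Require Import ring lra.
From mathcomp Require Import all_classical all_reals all_analysis.
From mathcomp Require Import measurable_realfun lebesgue_integral_under.
Set Implicit Arguments.
Unset Strict Implicit.
Unset Printing Implicit Defensive.
Import Order.TTheory GRing.Theory Num.Theory.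
Import numFieldNormedType.Exports.
Local Open Scope classical_set_scope.
Local Open Scope ring_scope.

(** * Substitution along an increasing map of the whole line *)

Section substitution.
Context {R : realType}.
Notation mu := (@lebesgue_measure R).
Implicit Types F G : R -> R.

(** All integrals are improper, and their convergence is part of the claim. The integral identities
    are therefore proved for nonnegative integrands in the extended reals, where monotone
    convergence and Tonelli apply, and finiteness is read off from the closed forms; only the Gamma
    integral receives a direct estimate. Writing integrands as exponentials on the whole line turns
    products and Jacobians into sums of exponents, and lets one domination serve both families: for
    |s' - s| <= e, the product |phi|^k exp(s' phi) is at most a constant times exp((s + 2e) phi) +
    exp((s - 2e) phi). This takes room on both sides of s, so convergence is established on open
    intervals; the one for the density contains 1. The moments of ln f are never integrated
    directly: they come from comparing the derivative of exp L under the integral sign with the one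
    given by the chain rule. *)

Lemma derivable_continuous F : (forall x, derivable F x 1) -> continuous F.
Proof. by move=> dF x; exact/differentiable_continuous/derivable1_diffP/dF. Qed.

(** Exhausts the range, which may be open or unbounded, by segments on which the substitution rule
    for compact intervals applies. One inclusion is monotonicity, the other the intermediate value
    theorem. *)
Lemma range_bigcup_itv F : continuous F -> {homo F : x y / x < y} ->
  range F = \bigcup_n `[F (- n%:R), F n%:R]%classic.
Proof.
move=> cF incF; have leF : {homo F : x y / x <= y}.
  by move=> x y; rewrite le_eqVlt => /predU1P[->//|/incF/ltW].
apply/seteqP; split => [_ [x _ <-]|y [n _]] /=.
  have /andP[xn nx] : - (Num.truncn `|x|).+1%:R <= x <= (Num.truncn `|x|).+1%:R.
    by rewrite -ler_norml ltW// truncnS_gt.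
  by exists (Num.truncn `|x|).+1 => //=; rewrite in_itv/= !leF.
rewrite in_itv/= => /andP[Fny yFn].
have nn : - n%:R <= n%:R :> R by rewrite ge0_cp.
have [|c _ <-] := @IVT _ F _ _ y nn (continuous_subspaceT cF); last by exists c.
by rewrite (min_idPl _) ?(max_idPr _) ?Fny ?yFn// leF.
Qed.

(** Both sides are limits of integrals over [[F (- n), F n]] and [[- n, n]], which agree for each n;
    the signs of the integrands give monotone convergence, so the identity also covers infinite
    values. Continuity of [G] is asked at the points of the range, which suits t^(a - 1) on the
    positive half-line. *)
Lemma ge0_integration_by_substitution_range F G :
  {homo F : x y / x < y} -> (forall x, derivable F x 1) ->
  continuous (derive1 F) -> (forall x, {for F x, continuous G}) ->
  (forall x, 0 <= G (F x)) ->
  (\int[mu]_(y in range F) (G y)%:E =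
   \int[mu]_x (G (F x) * derive1 F x)%:E)%E.
Proof.
move=> incF dF cF' cG G0.
have cF := derivable_continuous dF.
have leF : {homo F : x y / x <= y}.
  by move=> x y; rewrite le_eqVlt => /predU1P[->//|/incF/ltW].
have F'0 x : 0 <= derive1 F x.
  apply: (@incr_derive1_ge0 _ _ setT) => //.
  - by move=> ? ? _ _; exact: incF.
  - by rewrite interiorT.
have cGF : continuous (fun x => G (F x)).
  by move=> x; apply: continuous_comp; [exact: cF|exact: cG].
have cGF' : continuous (fun x => G (F x) * derive1 F x).
  by move=> x; apply: cvgM; [exact: cGF|exact: cF'].
have Gsub n : {within `[F (- n%:R), F n%:R]%classic, continuous G}.
  apply: continuous_in_subspaceT => y /set_mem yn.
  have : (range F) y by rewrite range_bigcup_itv//; exists n.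
  by move=> [x _ <-]; exact: cG.
have nn n : - n%:R <= n%:R :> R by rewrite ge0_cp.
pose I n := (\int[mu]_(y in `[(F (- n%:R))%R, (F n%:R)%R]) (G y)%:E)%E.
have I1 : I n @[n --> \oo] --> (\int[mu]_(y in range F) (G y)%:E)%E.
  rewrite range_bigcup_itv//; apply: ge0_nondecreasing_set_cvg_integral => //.
  - move=> m n mn; apply/subsetPset; apply: subset_itv; rewrite bnd_simp leF//.
      by rewrite lerN2 ler_nat.
    by rewrite ler_nat.
  - move=> n; apply/measurable_EFinP; apply: subspace_continuous_measurable_fun => //.
  - move=> n y yn; have : (range F) y by rewrite range_bigcup_itv//; exists n.
    by move=> [x _ <-]; rewrite lee_fin.
have RU : [set: R] = \bigcup_n `[- n%:R, n%:R]%classic :> set R.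
  have := @range_bigcup_itv id (fun x => cvg_id) (fun x y xy => xy).
  by rewrite image_id.
have I2 : I n @[n --> \oo] --> (\int[mu]_x (G (F x) * derive1 F x)%:E)%E.
  rewrite RU.
  have -> : I = fun n =>
      (\int[mu]_(x in `[(- n%:R)%R, n%:R%R]) (G (F x) * derive1 F x)%:E)%E.
    apply/funext => n.
    rewrite /I integration_by_substitution_increasing//.
    - by move=> x y _ _; exact: incF.
    - by apply: (cvgP (derive1 F (- n%:R))); apply: cvg_at_right_filter; exact: cF'.
    - by apply: (cvgP (derive1 F n%:R)); apply: cvg_at_left_filter; exact: cF'.
    - split; first by move=> *; exact: dF.
      + by apply: cvg_at_right_filter; exact: cF.
      + by apply: cvg_at_left_filter; exact: cF.
  apply: ge0_nondecreasing_set_cvg_integral => //.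
  - move=> m n mn; apply/subsetPset; apply: subset_itv; rewrite bnd_simp.
      by rewrite lerN2 ler_nat.
    by rewrite ler_nat.
  - move=> n; apply/measurable_EFinP; apply: measurable_funTS.
    exact: continuous_measurable_fun.
  - by move=> n x _; rewrite lee_fin mulr_ge0.
exact: (cvg_unique _ I1 I2).
Qed.

End substitution.

(** * Gamma and Beta integrals as integrals of exponentials over the line *)

Section gamma_beta_integrals.
Context {R : realType}.
Notation mu := (@lebesgue_measure R).
Implicit Types (a b k s t : R) (G : R -> R).

Lemma ge0_integral_shift G k : continuous G -> (forall x, 0 <= G x) ->
  (\int[mu]_x (G (x + k))%:E = \int[mu]_x (G x)%:E)%E.
Proof.
move=> cG G0.
have dF x : is_derive (x : R) (1 : R) (fun y : R => y + k) 1.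
  by apply: is_derive_eq; rewrite addr0.
have F'E : derive1 (fun y : R => y + k) = cst 1.
  by apply/funext => x; rewrite derive1E derive_val.
have rF : range (fun y : R => y + k) = setT.
  by apply/seteqP; split => // y _; exists (y - k) => //=; rewrite subrK.
rewrite -[in RHS]rF ge0_integration_by_substitution_range//.
- by apply: eq_integral => x _; rewrite F'E mulr1.
- by move=> x y; rewrite ltrD2r.
- by rewrite F'E => x; exact: cvg_cst.
- by move=> x; exact: cG.
Qed.

Lemma range_expR : range (@expR R) = `]0, +oo[%classic.
Proof.
apply/seteqP; split => [_ [x _ <-]|y]; rewrite /= in_itv/= andbT.
  exact: expR_gt0.
by move=> y0; exists (ln y) => //; rewrite lnK.
Qed.

(** Substitution t = exp s: the Jacobian exp s raises the exponent a - 1 to a. *)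
Lemma gamma_integral_expR a :
  (\int[mu]_(t in `]0%R, +oo[) (t `^ (a - 1) * expR (- t))%:E =
   \int[mu]_s (expR (a * s - expR s))%:E)%E.
Proof.
have DexpR : derive1 (@expR R) = expR by rewrite funeqE => x; rewrite derive1E derive_val.
rewrite -range_expR (@ge0_integration_by_substitution_range _ expR (fun t => t `^ (a - 1) * expR (- t))).
- apply: eq_integral => s _; congr EFin.
  rewrite DexpR -expRM -!expRD; congr expR; ring.
- by move=> x y; rewrite ltr_expR.
- exact: derivable_expR.
- by rewrite DexpR; exact: continuous_expR.
- move=> x; have cP : {for expR x, continuous (fun t => t `^ (a - 1))}.
    apply/differentiable_continuous/derivable1_diffP/derivable_powR.
    by rewrite in_itv/= expR_gt0.
  apply: cvgM; first exact: cP.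
  by apply: continuous_comp; [exact: continuousN|exact: continuous_expR].
- by move=> x; rewrite mulr_ge0// ?powR_ge0 ?expR_ge0.
Qed.

Lemma continuous_gamma_integrand a k : continuous (fun s => expR (a * s - k * expR s)).
Proof.
move=> s; apply: continuous_comp; last exact: continuous_expR.
apply: cvgB; first by apply: cvgM; [exact: cvg_cst|exact: cvg_id].
by apply: cvgM; [exact: cvg_cst|exact: continuous_expR].
Qed.

Lemma continuous_gamma_integrand1 a : continuous (fun s => expR (a * s - expR s)).
Proof.
have -> : (fun s => expR (a * s - expR s)) = (fun s => expR (a * s - 1 * expR s)).
  by apply/funext => s; rewrite mul1r.
exact: continuous_gamma_integrand.
Qed.

Lemma measurable_gamma_integrand a :
  measurable_fun setT (fun s => (expR (a * s - expR s))%:E).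
Proof.
by apply/measurable_EFinP; apply: continuous_measurable_fun; exact: continuous_gamma_integrand1.
Qed.

(** The left side is largest at s = ln q; the bound is the tangent inequality for exp at that
    point. *)
Lemma mulr_sub_expR_le q s : 0 < q -> q * s - expR s <= q * ln q - q.
Proof.
move=> q0; have := expR_ge1Dx (s - ln q).
rewrite expRB lnK// ler_pdivlMr//; nra.
Qed.

Lemma gamma_integral_lty a : 0 < a ->
  (\int[mu]_s (expR (a * s - expR s))%:E < +oo)%E.
Proof.
(* The integrand is dominated by a multiple of the derivative F' of a logistic
   function F, and F' has integral at most 1 since F takes values in [0, 1]. *)
move=> a0; pose p := a / 2; have p0 : 0 < p by rewrite divr_gt0.
pose F s := (1 + expR (- (p * s)))^-1.
pose F' s := p * expR (- (p * s)) / (1 + expR (- (p * s))) ^+ 2.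
have F0 s : 0 < 1 + expR (- (p * s)) by rewrite addr_gt0// expR_gt0.
have dF s : is_derive s 1 F (F' s).
  have h : is_derive s 1 (fun s => 1 + expR (- (p * s))) (- p * expR (- (p * s))).
    apply: is_derive_eq; rewrite add0r /GRing.scale/= ; ring.
  have := @is_deriveV R (fun s => 1 + expR (- (p * s))) s _ 1 (lt0r_neq0 (F0 s)) h.
  move=> /is_derive_eq; apply.
  rewrite /GRing.scale/= /F' expr2 invfM; ring.
have F'E : derive1 F = F' by apply/funext => s; rewrite derive1E derive_val.
have incF : {homo F : x y / x < y}.
  move=> x y xy; rewrite /F ltf_pV2 ?posrE// ltrD2l ltr_expR ltrN2.
  by rewrite ltr_pM2l.
have cE : continuous (fun s => expR (- (p * s))).
  move=> s; apply: continuous_comp; last exact: continuous_expR.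
  by apply: cvgN; apply: cvgM; [exact: cvg_cst|exact: cvg_id].
have cF' : continuous F'.
  move=> s; apply: cvgM.
    by apply: cvgM; [exact: cvg_cst|exact: cE].
  apply: cvgV; first by rewrite expf_neq0// lt0r_neq0.
  have c1 : {for s, continuous (fun s => 1 + expR (- (p * s)))}.
    by apply: cvgD; [exact: cvg_cst|exact: cE].
  by under eq_fun do rewrite expr2; rewrite expr2; apply: cvgM.
have F'0 s : 0 <= F' s by rewrite divr_ge0 ?mulr_ge0 ?exprn_ge0 ?expR_ge0 ?ltW.
have IF' : (\int[mu]_s (F' s)%:E <= 1)%E.
  have -> : (\int[mu]_s (F' s)%:E = \int[mu]_(y in range F) (cst 1 y)%:E)%E.
    rewrite ge0_integration_by_substitution_range//.
    - by apply: eq_integral => s _; rewrite mul1r F'E.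
    - by rewrite F'E.
    - by move=> s; exact: cvg_cst.
  have rF : range F `<=` `[0, 1].
    move=> _ [s _ <-] /=; rewrite in_itv/= invr_ge0 ltW//=.
    by rewrite invf_le1// lerDl expR_ge0.
  have mF : measurable (range F).
    rewrite range_bigcup_itv//; first by apply: bigcup_measurable => n _; exact: measurable_itv.
    by apply: derivable_continuous => s; case: (dF s).
  rewrite -[leLHS]/(\int[mu]_(y in range F) (cst 1 y))%E integral_cst// mul1e.
  apply: (@le_trans _ _ (mu `[0%R, 1%R]%classic)); first by apply: le_measure; rewrite ?inE.
  by rewrite lebesgue_measure_itv/= lte_fin ltr01 oppr0 adde0.
(* With X = exp(- p s), the integrand times (1 + X)^2 / X is the sum of the integrands with
   exponents a + p, a (twice) and a - p, each bounded by [B] at its exponent. The choice p = a / 2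
   keeps a - p positive, and [K] divides by p because F' carries that factor. *)
pose B (q : R) := expR (q * ln q - q).
pose K := (B (a + p) + 2 * B a + B (a - p)) / p.
have ap : a - p = p by rewrite /p; field.
have hF s : expR (a * s - expR s) <= K * F' s.
  have E0 := F0 s; have X0 := expR_gt0 (- (p * s)).
  have -> : K * F' s = (B (a + p) + 2 * B a + B (a - p)) * (expR (- (p * s)) / (1 + expR (- (p * s))) ^+ 2).
    rewrite /K /F'; field; rewrite !gt_eqF//.
  rewrite mulrA ler_pdivlMr ?exprn_gt0//.
  have h q : 0 < q -> expR (q * s - expR s) <= B q.
    by move=> q0; rewrite ler_expR mulr_sub_expR_le.
  have h1 := h (a + p) (addr_gt0 a0 p0); have h2 := h a a0.
  have h3 : expR ((a - p) * s - expR s) <= B (a - p) by apply: h; rewrite ap.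
  have e1 : expR ((a + p) * s - expR s) * expR (- (p * s)) = expR (a * s - expR s).
    by rewrite -expRD; congr expR; ring.
  have e2 : expR ((a - p) * s - expR s) = expR (a * s - expR s) * expR (- (p * s)).
    by rewrite -expRD; congr expR; ring.
  move: h1 h2 h3 e1; rewrite e2.
  move: (expR (- (p * s))) (expR (a * s - expR s)) (expR ((a + p) * s - expR s)) X0 => X h0 h1 X0 ? ? ? ?.
  nra.
apply: (@le_lt_trans _ _ (\int[mu]_s (K%:E * (F' s)%:E))%E).
  apply: ge0_le_integral => //.
  - exact: measurable_gamma_integrand.
  - by apply/measurable_EFinP; apply: continuous_measurable_fun => s; apply: cvgM; [exact: cvg_cst|exact: cF'].
  - by move=> s _; rewrite lee_fin.
have K0 : 0 <= K by rewrite divr_ge0 ?addr_ge0 ?mulr_ge0 ?expR_ge0// ltW.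
rewrite ge0_integralZl//.
- by apply: lte_mul_pinfty => //; apply: (le_lt_trans IF'); exact: ltry.
- by apply/measurable_EFinP; exact: continuous_measurable_fun.
- by move=> s _; rewrite lee_fin.
Qed.

Lemma gamma_integralE a : 0 < a ->
  (\int[mu]_s (expR (a * s - expR s))%:E = (Gamma a)%:E)%E.
Proof.
move=> a0; rewrite /Gamma /Rintegral gamma_integral_expR fineK//.
by rewrite ge0_fin_numE ?gamma_integral_lty// integral_ge0.
Qed.

Lemma Gamma_gt0 a : 0 < a -> 0 < Gamma a.
Proof.
move=> a0; rewrite -lte_fin -gamma_integralE//.
have mG := measurable_gamma_integrand a.
apply: (@lt_le_trans _ _ (\int[mu]_(s in `[0%R, 1%R]) (cst (expR (- expR 1))%:E s))%E).
  rewrite integral_cst//= lebesgue_measure_itv/= lte_fin ltr01 oppr0 adde0 mule1.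
  by rewrite lte_fin expR_gt0.
apply: (@le_trans _ _ (\int[mu]_(s in `[0%R, 1%R]) (expR (a * s - expR s))%:E)%E).
  apply: ge0_le_integral => //.
  - by move=> s _; rewrite lee_fin expR_ge0.
  - exact: measurable_funTS.
  - move=> s /=; rewrite in_itv/= => /andP[s0 s1]; rewrite lee_fin ler_expR.
    by rewrite -[leLHS]add0r lerD ?mulr_ge0 ?(ltW a0)// lerN2 ler_expR.
by apply: ge0_subset_integral => // s _; rewrite lee_fin expR_ge0.
Qed.

(** Translating s by - ln k replaces k exp s by exp s and leaves the factor k^(- a), written as an
    exponential. *)
Lemma gamma_integral_scale a k : 0 < a -> 0 < k ->
  (\int[mu]_s (expR (a * s - k * expR s))%:E = (expR (- (a * ln k)) * Gamma a)%:E)%E.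
Proof.
move=> a0 k0.
rewrite -(ge0_integral_shift (- ln k)); [|exact: continuous_gamma_integrand|by move=> ?; exact: expR_ge0].
rewrite EFinM -gamma_integralE// -ge0_integralZl//; last exact: measurable_gamma_integrand.
apply: eq_integral => s _; rewrite -EFinM -expRD expRD expRN lnK//; congr (expR _)%:E.
by field; rewrite gt_eqF.
Qed.

Lemma Beta_gt0 a b : 0 < a -> 0 < b -> 0 < Beta a b.
Proof. by move=> a0 b0; rewrite divr_gt0 ?mulr_gt0 ?Gamma_gt0 ?addr_gt0. Qed.

Lemma beta_integralE a b : 0 < a -> 0 < b ->
  (\int[mu]_t (expR (b * t - (a + b) * ln (1 + expR t)))%:E = (Beta a b)%:E)%E.
Proof.
move=> a0 b0; have ab0 := addr_gt0 a0 b0.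
(* The product of exp(a s - exp s) and exp(b (t + s) - exp(t + s)), that is, of the two Gamma
   integrands with the second translated by s. Integrating in t first gives [Gamma a * Gamma b];
   integrating in s first is [gamma_integral_scale] with k = 1 + exp t and exponent a + b. *)
pose f (z : R * R) := expR ((a + b) * z.1 + b * z.2 - (1 + expR z.2) * expR z.1).
have mf : measurable_fun setT (fun z => (f z)%:E).
  apply/measurable_EFinP; apply: measurableT_comp => //.
  apply: measurable_funB; first by apply: measurable_funD; exact: measurable_funM.
  apply: measurable_funM; last exact: measurableT_comp.
  by apply: measurable_funD => //; exact: measurableT_comp.
have f0 z : (0 <= (f z)%:E)%E by rewrite lee_fin expR_ge0.
have mB : measurable_fun setT (fun t : R => (expR (b * t - (a + b) * ln (1 + expR t)))%:E).
  apply/measurable_EFinP; apply: measurableT_comp => //.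
  apply: measurable_funB; first exact: measurable_funM.
  apply: measurable_funM => //; apply: measurableT_comp => //.
  exact: measurable_funD.
have : (\int[mu]_s \int[mu]_t (f (s, t))%:E = (Gamma a)%:E * (Gamma b)%:E)%E.
  rewrite muleC -(gamma_integralE a0) -ge0_integralZl//; last 2 first.
  - exact: measurable_gamma_integrand.
  - by rewrite lee_fin ltW// Gamma_gt0.
  apply: eq_integral => s _; rewrite muleC -(gamma_integralE b0).
  rewrite -(@ge0_integral_shift (fun t => expR (b * t - expR t)) s); last 2 first.
  - exact: continuous_gamma_integrand1.
  - by move=> ?; exact: expR_ge0.
  rewrite -ge0_integralZl//; last first.
    apply/measurable_EFinP; apply: measurableT_comp => //.
    apply: measurable_funB; first by apply: measurable_funM => //; exact: measurable_funD.
    by apply: measurableT_comp => //; exact: measurable_funD.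
  apply: eq_integral => t _; rewrite -EFinM -expRD /f/=; congr (expR _)%:E.
  by rewrite expRD; ring.
have FT := @fubini_tonelli _ _ _ _ R mu mu _ mf f0.
rewrite [X in X = _ -> _]FT {FT}.
under eq_integral => t _.
  under eq_integral => s _.
    have -> : f (s, t) = expR (b * t) * expR ((a + b) * s - (1 + expR t) * expR s).
      by rewrite /f -expRD/=; congr expR; ring.
    rewrite EFinM; over.
  rewrite ge0_integralZl//; last first.
    apply/measurable_EFinP; apply: continuous_measurable_fun.
    exact: continuous_gamma_integrand.
  rewrite gamma_integral_scale//.
  rewrite -EFinM mulrA -expRD mulrC EFinM; over.
rewrite /= ge0_integralZl//; last by rewrite lee_fin ltW// Gamma_gt0.
have G0 := Gamma_gt0 ab0.
rewrite -EFinM => h.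
by rewrite /Beta [in RHS]mulrC EFinM -h muleA -EFinM mulVf ?gt_eqF// mul1e.
Qed.

End gamma_beta_integrals.

(** * Moment generating functions and differentiation under the integral *)

Section exponential_moments.
Context d (T : measurableType d) (R : realType) (mu : {measure set T -> \bar R}).
Variables (h phi : T -> R) (u v : R).
Hypotheses (mh : measurable_fun setT h) (mphi : measurable_fun setT phi).
Hypothesis h_ge0 : forall x, 0 <= h x.
Hypothesis mgf_lty : forall s, u < s < v ->
  (\int[mu]_x (h x * expR (s * phi x))%:E < +oo)%E.

(** The k-th derivative in s of h exp(s phi): differentiation in s raises k by one. *)
Definition exp_moment k s x := phi x ^+ k * (h x * expR (s * phi x)).

Let measurable_exp_moment k s : measurable_fun setT (exp_moment k s).
Proof.
apply: measurable_funM; first exact: measurable_funX.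
by apply: measurable_funM => //; apply: measurableT_comp => //; exact: measurable_funM.
Qed.

Let exprn_le_expR (x : R) k : 0 <= x -> x ^+ k <= k`!%:R * expR x.
Proof.
move=> x0; case: k => [|k]; first by rewrite expr0 mul1r -expR0 ler_expR.
rewrite mulrC -ler_pdivrMr ?ltr0n ?fact_gt0//.
by apply: le_trans (expR_ge1Dxn k x0); rewrite lerDr.
Qed.

(** The exponential series gives |phi|^k <= k! / e^k exp(e |phi|). This factor and the move from s
    to s' each cost at most e |phi| in the exponent, whence 2e; the sum of two exponentials covers
    both signs of phi. The bound is independent of s', as dominated differentiation requires. *)
Lemma le_exp_moment k (s s' e : R) x : 0 < e -> `|s' - s| <= e ->
  `|exp_moment k s' x| <=
  k`!%:R / e ^+ k * (h x * expR ((s + 2 * e) * phi x) + h x * expR ((s - 2 * e) * phi x)).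
Proof.
move=> e0 ss'; rewrite /exp_moment !normrM (ger0_norm (h_ge0 x)) (ger0_norm (expR_ge0 _)).
rewrite -mulrDr !(mulrCA _ (h x)) ler_wpM2l//.
have p0 : 0 <= `|phi x| by [].
apply: (@le_trans _ _ (k`!%:R / e ^+ k * expR (e * `|phi x|) * expR (s' * phi x))).
  rewrite ler_wpM2r ?expR_ge0// mulrAC ler_pdivlMr ?exprn_gt0// normrX mulrC -exprMn.
  by apply: exprn_le_expR; rewrite mulr_ge0// ltW.
rewrite -mulrA ler_wpM2l ?divr_ge0 ?exprn_ge0 ?(ltW e0)// -expRD.
have [q0|q0] := leP 0 (phi x).
  apply: (@le_trans _ _ (expR ((s + 2 * e) * phi x))); last by rewrite lerDl expR_ge0.
  rewrite ler_expR ger0_norm//.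
  by move: ss'; rewrite ler_norml => /andP[]; nra.
apply: (@le_trans _ _ (expR ((s - 2 * e) * phi x))); last by rewrite lerDr expR_ge0.
rewrite ler_expR ltr0_norm//.
by move: ss'; rewrite ler_norml => /andP[]; nra.
Qed.

Let bound_ex s : u < s < v ->
  exists2 e : R, 0 < e & u < s - 2 * e /\ s + 2 * e < v.
Proof.
move=> /andP[us sv]; exists (Num.min (s - u) (v - s) / 4).
  by rewrite divr_gt0// lt_min !subr_gt0 us.
set m := Num.min _ _.
have m1 : m <= s - u by rewrite ge_min lexx.
have m2 : m <= v - s by rewrite ge_min lexx orbT.
split; lra.
Qed.

Let integrable_mgf s : u < s < v ->
  mu.-integrable setT (fun x => (h x * expR (s * phi x))%:E).
Proof.
move=> suv; apply/integrableP; split.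
  apply/measurable_EFinP.
  by apply: measurable_funM => //; apply: measurableT_comp => //; exact: measurable_funM.
have := mgf_lty suv; congr (_ < _)%E; apply: eq_integral => x _.
by rewrite gee0_abs// lee_fin mulr_ge0// expR_ge0.
Qed.

Let integrable_bound (c s e : R) : u < s - 2 * e -> s + 2 * e < v -> 0 < e ->
  mu.-integrable setT (EFin \o (fun x => c *
    (h x * expR ((s + 2 * e) * phi x) + h x * expR ((s - 2 * e) * phi x)))).
Proof.
move=> h1 h2 e0.
have i1 : u < s + 2 * e < v by apply/andP; split; lra.
have i2 : u < s - 2 * e < v by apply/andP; split; lra.
exact: (integrableZl measurableT c (integrableD measurableT (integrable_mgf i1) (integrable_mgf i2))).
Qed.

Lemma integrable_exp_moment k s : u < s < v ->
  mu.-integrable setT (EFin \o exp_moment k s).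
Proof.
move=> /bound_ex[e e0 [h1 h2]].
apply: le_integrable (integrable_bound (k`!%:R / e ^+ k) h1 h2 e0) => //.
  by apply/measurable_EFinP.
move=> x _ /=; rewrite lee_fin; apply: le_trans (ler_norm _).
by apply: le_exp_moment => //; rewrite subrr normr0 ltW.
Qed.

Let is_derive_exp_moment_pt k (s : R) x :
  is_derive s 1 (fun s => exp_moment k s x) (exp_moment k.+1 s x).
Proof.
rewrite /exp_moment; apply: is_derive_eq.
by rewrite /GRing.scale/= exprS; ring.
Qed.

Lemma is_derive_exp_moment k (s : R) : u < s < v ->
  is_derive s 1 (fun s => \int[mu]_x exp_moment k s x) (\int[mu]_x exp_moment k.+1 s x).
Proof.
move=> /[dup] suv /bound_ex[e e0 [h1 h2]].
pose G x := k.+1`!%:R / e ^+ k.+1 *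
  (h x * expR ((s + 2 * e) * phi x) + h x * expR ((s - 2 * e) * phi x)).
have sI : `](s - e), (s + e)[%classic s by rewrite /= in_itv/=; apply/andP; split; lra.
have d1 s' x : partial1of2 (exp_moment k) s' x = exp_moment k.+1 s' x.
  by rewrite partial1of2E; have := is_derive_exp_moment_pt k s' x => ?; rewrite derive_val.
have intf s' : `](s - e), (s + e)[%classic s' -> mu.-integrable setT (EFin \o exp_moment k s').
  by rewrite /= in_itv/= => /andP[? ?]; apply: integrable_exp_moment; apply/andP; split; lra.
have derf s' x : `](s - e), (s + e)[%classic s' -> setT x -> derivable (exp_moment k ^~ x) s' 1.
  by move=> _ _; case: (is_derive_exp_moment_pt k s' x).
have G0 x : 0 <= G x.
  by rewrite mulr_ge0 ?addr_ge0 ?mulr_ge0 ?expR_ge0 ?invr_ge0 ?exprn_ge0// ltW.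
have intG : mu.-integrable setT (EFin \o G) by exact: integrable_bound.
have Gub s' x : `](s - e), (s + e)[%classic s' -> setT x -> `|partial1of2 (exp_moment k) s' x| <= G x.
  rewrite /= in_itv/= => /andP[? ?] _; rewrite d1; apply: le_exp_moment => //.
  by rewrite ler_norml; apply/andP; split; lra.
apply: DeriveDef; first exact: (derivable_under_integral measurableT sI intf derf G0 intG Gub).
rewrite -derive1E (differentiation_under_integral measurableT sI intf derf G0 intG Gub).
by apply: eq_Rintegral => x _; rewrite d1.
Qed.

End exponential_moments.

(** * The logarithm of Beta and the derivatives of ln Gamma *)

Lemma BetaC {R : realType} (a b : R) : Beta a b = Beta b a.
Proof. by rewrite /Beta (mulrC (Gamma a)) (addrC a). Qed.

Lemma ln_Beta {R : realType} (x y : R) : 0 < x -> 0 < y ->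
  ln (Beta x y) = ln (Gamma x) + ln (Gamma y) - ln (Gamma (x + y)).
Proof.
by move=> x0 y0; rewrite /Beta ln_div ?lnM// posrE ?mulr_gt0 ?Gamma_gt0 ?addr_gt0.
Qed.

Section gamma_derivatives.
Context {R : realType}.
Notation mu := (@lebesgue_measure R).

Let gamma_moment k (a : R) : R :=
  \int[mu]_s exp_moment (fun s : R => expR (- expR s)) id k a s.

Let is_derive_gamma_moment k (a : R) : 0 < a ->
  is_derive a 1 (gamma_moment k) (gamma_moment k.+1 a).
Proof.
move=> a0; apply: (@is_derive_exp_moment _ _ _ mu _ _ 0 (a + 1)) => //.
- by apply: measurableT_comp => //; exact: measurableT_comp.
- move=> s /andP[s0 _]; apply: le_lt_trans (gamma_integral_lty s0).
  by under eq_integral do rewrite -expRD addrC.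
- by rewrite a0 ltrDl/=.
Qed.

Let Gamma_moment (a : R) : 0 < a -> Gamma a = gamma_moment 0 a.
Proof.
move=> a0; rewrite /gamma_moment /Rintegral.
under eq_integral do rewrite /exp_moment expr0 mul1r -expRD addrC.
by rewrite gamma_integralE.
Qed.

Let near_gt0 (a : R) : 0 < a -> \forall x \near a, 0 < x.
Proof. exact: lt_nbhsr. Qed.

Let is_derive_Gamma_moment (a : R) : 0 < a -> is_derive a 1 Gamma (gamma_moment 1 a).
Proof.
move=> a0; apply: (@near_eq_is_derive _ _ _ (gamma_moment 0)) => //.
  by apply: filterS (near_gt0 a0) => x x0; rewrite Gamma_moment.
exact: is_derive_gamma_moment.
Qed.

Lemma is_derive_ln_Gamma (a : R) : 0 < a ->
  is_derive a 1 (fun x : R => ln (Gamma x)) (digamma a).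
Proof.
move=> a0; have dG := is_derive_Gamma_moment a0.
have dln := is_derive1_ln (Gamma_gt0 a0).
apply: (is_derive_eq (is_derive1_comp dln dG)).
by rewrite /digamma derive1E derive_val mulrC.
Qed.

Lemma is_derive_digamma (a : R) : 0 < a -> is_derive a 1 digamma (trigamma a).
Proof.
move=> a0; rewrite /trigamma derive1E; apply: DeriveDef => //.
have d1 := is_derive_gamma_moment 1 a0.
have dG := is_derive_Gamma_moment a0.
have G0 : Gamma a != 0 by rewrite gt_eqF// Gamma_gt0.
apply: (@near_eq_derivable _ _ _ (fun x => gamma_moment 1 x * (Gamma x)^-1)) => //.
  apply: filterS (near_gt0 a0) => x x0.
  have dGx := is_derive_Gamma_moment x0.
  by rewrite /digamma derive1E derive_val.
Qed.

End gamma_derivatives.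

(** * Powers of the skew t density and their integrals *)

Section skew_t_integrals.
Context {R : realType}.
Notation mu := (@lebesgue_measure R).
Variables gamma beta : R.
Hypotheses (gamma_gt0 : 0 < gamma) (beta_gt0 : 0 < beta).

Let c_gt0 : 0 < gamma + beta. Proof. exact: addr_gt0. Qed.

Let root (x : R) := Num.sqrt (gamma + beta + x ^+ 2).

Let root_gt0 x : 0 < root x.
Proof. by rewrite sqrtr_gt0 ltr_pwDl// sqr_ge0. Qed.

Let norm_lt_root x : `|x| < root x.
Proof. by rewrite -sqrtr_sqr ltr_sqrt ?ltrDr// ltr_pwDl// sqr_ge0. Qed.

Let ratio_lt x : -1 < x / root x < 1.
Proof.
rewrite -ltr_norml normrM normfV (gtr0_norm (root_gt0 x)).
by rewrite ltr_pdivrMr// mul1r.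
Qed.

Let plus_gt0 x : 0 < 1 + x / root x.
Proof. by have /andP[] := ratio_lt x; lra. Qed.

Let minus_gt0 x : 0 < 1 - x / root x.
Proof. by have /andP[] := ratio_lt x; lra. Qed.

(** This is the function phi of the moment lemmas: with h = 1, powers of the density are
    exponentials linear in the exponent. *)
Definition ln_skew_t x :=
  (gamma + 2^-1) * ln (1 + x / root x) + (beta + 2^-1) * ln (1 - x / root x)
  - (ln (Beta gamma beta) + ln (Num.sqrt (gamma + beta)) + (gamma + beta - 1) * ln 2).

Lemma skew_tE x : skew_t gamma beta x = expR (ln_skew_t x).
Proof.
have B0 := Beta_gt0 gamma_gt0 beta_gt0.
have s0 : 0 < Num.sqrt (gamma + beta) by rewrite sqrtr_gt0.
rewrite /skew_t -/(root x) /powR !gt_eqF// /ln_skew_t expRB !expRD.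
by rewrite (@lnK _ (Beta _ _))// (@lnK _ (Num.sqrt _)).
Qed.

Lemma skew_t_gt0 x : 0 < skew_t gamma beta x.
Proof. by rewrite skew_tE expR_gt0. Qed.

Lemma ln_skew_tE x : ln (skew_t gamma beta x) = ln_skew_t x.
Proof. by rewrite skew_tE expRK. Qed.

Lemma skew_t_powR alpha x :
  skew_t gamma beta x `^ alpha = expR (alpha * ln_skew_t x).
Proof. by rewrite /powR gt_eqF ?skew_t_gt0// ln_skew_tE. Qed.

Lemma continuous_ln_skew_t : continuous ln_skew_t.
Proof.
have croot : continuous root.
  move=> x; apply: continuous_comp; last exact: sqrt_continuous.
  by apply: cvgD; [exact: cvg_cst|exact: exprn_continuous].
have cratio : continuous (fun x : R => x / root x).
  move=> x; apply: cvgM; first exact: cvg_id.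
  by apply: cvgV; [rewrite gt_eqF|exact: croot].
move=> x; apply: cvgB; last exact: cvg_cst.
apply: cvgD; (apply: cvgM; first exact: cvg_cst).
- have cp : {for x, continuous (fun x : R => 1 + x / root x)}.
    by apply: cvgD; [exact: cvg_cst|exact: cratio].
  by apply: (continuous_comp cp); exact: continuous_ln.
- have cp : {for x, continuous (fun x : R => 1 - x / root x)}.
    by apply: cvgB; [exact: cvg_cst|exact: cratio].
  by apply: (continuous_comp cp); exact: continuous_ln.
Qed.

Lemma continuous_expR_ln_skew_t alpha : continuous (fun x => expR (alpha * ln_skew_t x)).
Proof.
move=> x; apply: continuous_comp; last exact: continuous_expR.
by apply: cvgM; [exact: cvg_cst|exact: continuous_ln_skew_t].
Qed.

(* The substitution x = S t = sqrt(gamma + beta) sinh(t / 2), for which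
   x / sqrt(gamma + beta + x^2) = tanh(t / 2). *)
Let S t := Num.sqrt (gamma + beta) / 2 * (expR (t / 2) - expR (- (t / 2))).
Let S' t := Num.sqrt (gamma + beta) / 4 * (expR (t / 2) + expR (- (t / 2))).

Let sqrt_c_gt0 : 0 < Num.sqrt (gamma + beta). Proof. by rewrite sqrtr_gt0. Qed.

Let expR_half (t : R) : expR t = expR (t / 2) ^+ 2.
Proof. by rewrite -expRM_natl; congr expR; field. Qed.

(** The identity 1 + sinh^2 = cosh^2 at t / 2. *)
Let root_S t : root (S t) = Num.sqrt (gamma + beta) / 2 * (expR (t / 2) + expR (- (t / 2))).
Proof.
rewrite /root; set w := RHS.
have w0 : 0 <= w by rewrite mulr_ge0 ?addr_ge0 ?expR_ge0 ?divr_ge0 ?ltW.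
rewrite -[RHS]ger0_norm// -sqrtr_sqr; congr Num.sqrt.
rewrite -[X in X + _](sqr_sqrtr (ltW c_gt0)) /w /S expRN.
by field; rewrite gt_eqF// expR_gt0.
Qed.

Let ratio_S t : S t / root (S t) = (expR t - 1) / (1 + expR t).
Proof.
have E0 := expR_gt0 (t / 2); have s0 := sqrt_c_gt0.
rewrite root_S /S expRN [expR t]expR_half.
field; rewrite !gt_eqF ?addr_gt0 ?exprn_gt0//.
Qed.

Let ln_plus_S t : ln (1 + S t / root (S t)) = ln 2 + t - ln (1 + expR t).
Proof.
have E0 := expR_gt0 t; have E1 : 0 < 1 + expR t by rewrite addr_gt0.
have -> : 1 + S t / root (S t) = 2 * expR t / (1 + expR t).
  by rewrite ratio_S; field; rewrite gt_eqF.
by rewrite ln_div ?posrE ?mulr_gt0// lnM ?posrE// expRK.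
Qed.

Let ln_minus_S t : ln (1 - S t / root (S t)) = ln 2 - ln (1 + expR t).
Proof.
have E0 := expR_gt0 t; have E1 : 0 < 1 + expR t by rewrite addr_gt0.
have -> : 1 - S t / root (S t) = 2 / (1 + expR t).
  by rewrite ratio_S; field; rewrite gt_eqF.
by rewrite ln_div ?posrE.
Qed.

(** From exp(t / 2) + exp(- t / 2) = exp(- t / 2) (1 + exp t): in this form the Jacobian merges with
    the density into a single exponential. *)
Let S'E t : S' t = expR (ln (Num.sqrt (gamma + beta)) - 2 * ln 2 - t / 2 + ln (1 + expR t)).
Proof.
have E0 := expR_gt0 (t / 2); have E1 : 0 < 1 + expR t by rewrite addr_gt0 ?expR_gt0.
rewrite expRD !expRB !lnK ?posrE// expRM_natl lnK ?posrE// /S' expRN [expR t]expR_half.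
by field; rewrite !gt_eqF.
Qed.

Let derive1_S : (forall t, derivable S t 1) /\ derive1 S = S'.
Proof.
have dS (t : R) : is_derive t 1 S (S' t).
  rewrite /S; apply: is_derive_eq.
  by rewrite /GRing.scale/= /S'; field.
by split=> [t|]; [case: (dS t)|apply/funext => t; rewrite derive1E derive_val].
Qed.

Let S_increasing : {homo S : x y / x < y}.
Proof.
move=> x y xy; rewrite /S ltr_pM2l ?divr_gt0//.
by rewrite ltrB// ltr_expR; lra.
Qed.

Let range_S : range S = setT.
Proof.
apply/seteqP; split => // y _.
pose z := y / Num.sqrt (gamma + beta).
have r0 : `|z| < Num.sqrt (z ^+ 2 + 1).
  by rewrite -sqrtr_sqr ltr_sqrt ?ltrDl// ltr_wpDl// sqr_ge0.
have w0 : 0 < z + Num.sqrt (z ^+ 2 + 1).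
  by move: r0; rewrite ltr_norml => /andP[]; lra.
have r2 : Num.sqrt (z ^+ 2 + 1) ^+ 2 = z ^+ 2 + 1 by rewrite sqr_sqrtr// addr_ge0// sqr_ge0.
(* The inverse of [S]: t = 2 arsinh z, with arsinh z = ln(z + sqrt(z^2 + 1)). *)
exists (2 * ln (z + Num.sqrt (z ^+ 2 + 1))) => //.
rewrite /S (_ : 2 * _ / 2 = ln (z + Num.sqrt (z ^+ 2 + 1))); last by field.
rewrite expRN lnK//.
have -> : (z + Num.sqrt (z ^+ 2 + 1))^-1 = Num.sqrt (z ^+ 2 + 1) - z.
  apply: (mulfI (lt0r_neq0 w0)); rewrite mulfV ?gt_eqF//.
  by rewrite (addrC z) mulrC -subr_sqr r2; ring.
by rewrite /z; field; rewrite gt_eqF.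
Qed.

(** The Jacobian contributes - t / 2 + ln(1 + exp t) to the exponent, hence the [- 2^-1] in both
    Beta parameters. The powers of 2 in the density leave 2 alpha ln 2, of which the Jacobian
    removes 2 ln 2; this is the origin of 4^(alpha - 1). *)
Lemma integral_skew_t_powR alpha :
  0 < alpha * (gamma + 2^-1) - 2^-1 -> 0 < alpha * (beta + 2^-1) - 2^-1 ->
  (\int[mu]_x (expR (alpha * ln_skew_t x))%:E =
   (expR ((alpha - 1) * (2 * ln 2 - ln (Num.sqrt (gamma + beta)))
          - alpha * ln (Beta gamma beta))
    * Beta (alpha * (gamma + 2^-1) - 2^-1) (alpha * (beta + 2^-1) - 2^-1))%:E)%E.
Proof.
set a := alpha * (gamma + 2^-1) - 2^-1; set b := alpha * (beta + 2^-1) - 2^-1 => a0 b0.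
have [dS S'_E] := derive1_S.
(* The coefficient of t is a, while [beta_integralE] puts the second parameter there; hence the
   swap. *)
rewrite (BetaC a) EFinM -(beta_integralE b0 a0) -[in LHS]range_S.
have cS' : continuous (derive1 S).
  rewrite S'_E => t; apply: cvgM; first exact: cvg_cst.
  apply: cvgD; (apply: continuous_comp; last exact: continuous_expR).
    by apply: cvgM; [exact: cvg_id|exact: cvg_cst].
  by apply: cvgN; apply: cvgM; [exact: cvg_id|exact: cvg_cst].
have cG x : {for S x, continuous (fun y => expR (alpha * ln_skew_t y))}.
  exact: continuous_expR_ln_skew_t.
have G0 x : 0 <= expR (alpha * ln_skew_t (S x)) by exact: expR_ge0.
rewrite (ge0_integration_by_substitution_range S_increasing dS cS' cG G0).
rewrite -ge0_integralZl//; last first.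
  apply/measurable_EFinP; apply: measurableT_comp => //.
  apply: measurable_funB; first exact: measurable_funM.
  apply: measurable_funM => //; apply: measurableT_comp => //.
  exact: measurable_funD.
apply: eq_integral => t _; rewrite -EFinM S'_E S'E -!expRD; congr (expR _)%:E.
by rewrite /ln_skew_t ln_plus_S ln_minus_S /a /b; field.
Qed.

End skew_t_integrals.

(** Taylor's formula with Peano remainder. After one use of l'Hopital's rule, the remainder quotient
    (D(h + c) - D c - D2 h) / (2 h) tends to 0 by the definition of D2 as the derivative of D at
    c. *)
Lemma cvg_second_order {R : realType} (L D : R -> R) (c D2 : R) :
  (\forall x \near c, is_derive (x : R) (1 : R) L (D x)) -> is_derive c 1 D D2 ->
  (L (h + c) - L c - D c * h) / h ^+ 2 @[h --> (0 : R)^'] --> D2 / 2.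
Proof.
move=> dL dD.
have [e /= e0 eL] : exists2 e : R, 0 < e & forall h : R, `|h| < e -> is_derive (h + c) 1 L (D (h + c)).
  move: dL => /nbhs_ballP[e /= e0 eL]; exists e => // h he; apply: eL.
  by rewrite /ball/= opprD addrCA subrr addr0 normrN.
(* [lhopital] asks for a limit of df/dg over full neighbourhoods of 0, where the
   quotient at 0 itself is 0/0 = 0; subtracting the quadratic term makes 0 the limit. *)
pose f (h : R) := L (h + c) - L c - D c * h - D2 / 2 * h ^+ 2.
pose df (h : R) := D (h + c) - D c - D2 * h.
have dshift (h : R) : is_derive h 1 (fun h : R => h + c) 1.
  by apply: is_derive_eq; rewrite addr0.
have fdf (h : R) : `|h| < e -> is_derive h 1 f (df h).
  move=> he; have dLh := @is_derive1_comp R L (fun h => h + c) h _ _ (eL h he) (dshift h).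
  have dLh' : is_derive h 1 (fun h => L (h + c)) (D (h + c)).
    by apply: (is_derive_eq dLh); rewrite mulr1.
  by rewrite /f /df; apply: is_derive_eq; rewrite /GRing.scale/=; field.
have gdg (h : R) : is_derive h 1 (fun h : R => h ^+ 2) (2 * h).
  by apply: is_derive_eq; rewrite /GRing.scale/=; ring.
have ne (x : R) : x \in `](- e), e[ -> `|x| < e by rewrite in_itv/= ltr_norml.
have dfdg : df h / (2 * h) @[h --> (0 : R)] --> (0 : R).
  case: dD => dD D2E; have := dD.
  move=> /cvg_ex[/= l Dl].
  have lE : l = D2.
    by rewrite -D2E; apply/esym/cvg_lim.
  rewrite lE in Dl.
  apply/cvgrPdist_le => r r0; move/cvgrPdist_le : Dl => /(_ r r0) Dl.
  near=> h; rewrite sub0r normrN.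
  have [->|h0] := eqVneq h 0; first by rewrite mulr0 invr0 mulr0 normr0 ltW.
  have : `|D2 - h^-1 *: (D (h *: 1 + c) - D c)| <= r.
    by move: h0; near: h; move: Dl; rewrite /dnbhs /within/= near_withinE.
  rewrite /GRing.scale/= mulr1 => hr.
  have -> : df h / (2 * h) = - (2^-1 * (D2 - h^-1 * (D (h + c) - D c))).
    by rewrite /df; field.
  rewrite normrN normrM gtr0_norm ?invr_gt0//.
  apply: le_trans hr; rewrite -[leRHS]mul1r ler_wpM2r//.
  by rewrite invf_le1// ler1n.
have itv0 : (0 : R) \in `](- e), e[ by rewrite in_itv/= e0 oppr_lt0 e0.
have f0 : f x @[x --> (0 : R)] --> (0 : R).
  have n0 : `|0 : R| < e by rewrite normr0.
  have cf : {for 0, continuous f}.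
    by apply/differentiable_continuous/derivable1_diffP; case: (fdf 0 n0).
  move: cf; rewrite /prop_for /continuous_at.
  by rewrite {2}/f add0r subrr mulr0 expr0n mulr0 !subr0.
have g0 : (x : R) ^+ 2 @[x --> (0 : R)] --> (0 : R).
  by have := @exprn_continuous R 2 0; rewrite /continuous_at expr0n.
have := @lhopital R f df (fun h => h ^+ 2) (fun h => 2 * h) (- e) e 0 0 itv0 _ _ f0 g0 _ dfdg.
have H1 x : x \in `](- e), e[ `\ 0 -> is_derive x 1 f (df x).
  by rewrite inE => -[+ _] => /= xe; apply: fdf; exact: ne.
have H3 (x : R) : x \in `](- e), e[ `\ 0 -> 2 * x != 0.
  by rewrite inE => -[_ /= /eqP x0]; rewrite mulf_neq0.
move=> /(_ H1 (fun x _ => gdg x) H3) lim0.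
have : f x / x ^+ 2 + D2 / 2 @[x --> (0 : R)^'] --> 0 + D2 / 2.
  by apply: cvgD => //; exact: cvg_cst.
rewrite add0r; apply: cvg_trans; apply: near_eq_cvg; near=> x.
have x0 : x != 0 by near: x; exact: nbhs_dnbhs_neq.
by rewrite /f; field.
Unshelve. all: by end_near. Qed.

(** * Integration against a measure given by a density *)

Section density.
Context d (T : measurableType d) (R : realType).
Variables (nu : {finite_measure set T -> \bar R})
          (mu : {sigma_finite_measure set T -> \bar R}).
Variable f : T -> R.
Hypotheses (mf : measurable_fun setT f) (f_ge0 : forall x, 0 <= f x).
Hypothesis nuE : forall A, measurable A -> (nu A = \int[mu]_(x in A) (f x)%:E)%E.

(** [nu] is absolutely continuous with respect to [mu], and its Radon-Nikodym derivative equals [f]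
    almost everywhere because both have the same integral over every measurable set. *)
Lemma ge0_integral_density (g : T -> \bar R) :
  measurable_fun setT g -> (forall x, 0 <= g x)%E ->
  (\int[nu]_x g x = \int[mu]_x (g x * (f x)%:E))%E.
Proof.
move=> mg g0.
have numu : nu `<< mu.
  apply/null_content_dominatesP => A mA muA; rewrite nuE//.
  by apply: null_set_integral => //; apply/measurable_EFinP; exact: measurable_funTS.
rewrite -(Radon_Nikodym_SigmaFinite.change_of_variables numu)//.
have mRN : measurable_fun setT (Radon_Nikodym_SigmaFinite.f nu mu).
  exact: measurable_int (Radon_Nikodym_SigmaFinite.f_integrable numu).
apply: ae_eq_integral => //.
- exact: emeasurable_funM.
- by apply: emeasurable_funM => //; apply/measurable_EFinP.
- apply: ae_eqe_mul2l; apply: integral_ae_eq => //.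
  + exact: Radon_Nikodym_SigmaFinite.f_integrable.
  + by apply/measurable_EFinP.
  + move=> E _ mE; rewrite -nuE//.
    by rewrite -Radon_Nikodym_SigmaFinite.f_integral.
Qed.

(** The nonnegative case applies to the positive and negative parts of g, since multiplication by a
    nonnegative [f] commutes with taking the maximum with 0. *)
Lemma integral_density (g : T -> R) : measurable_fun setT g ->
  mu.-integrable setT (fun x => (g x * f x)%:E) ->
  nu.-integrable setT (EFin \o g) /\
  (\int[nu]_x (g x)%:E = \int[mu]_x (g x * f x)%:E)%E.
Proof.
move=> mg igf; have mEg : measurable_fun setT (EFin \o g) by apply/measurable_EFinP.
split.
  apply/integrableP; split => //.
  rewrite ge0_integral_density//; last exact: measurableT_comp.
  have /integrableP[_] := igf; congr (_ < _)%E; apply: eq_integral => x _.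
  by rewrite /= -EFinM normrM (ger0_norm (f_ge0 x)).
rewrite integralE [RHS]integralE; congr (_ - _)%E.
- rewrite ge0_integral_density//; last exact: measurable_funepos.
  apply: eq_integral => x _; rewrite unlock -[0%E]/(0%:E) -!EFin_max -EFinM.
  by rewrite maxr_pMl// mul0r.
- rewrite ge0_integral_density//; last exact: measurable_funeneg.
  apply: eq_integral => x _; rewrite unlock -[0%E]/(0%:E) -!EFinN -!EFin_max -EFinM.
  by rewrite maxr_pMl// mul0r mulNr.
Qed.

End density.

(** * Logarithmic moments of the skew t density *)

Section skew_t_moments.
Context {R : realType}.
Notation mu := (@lebesgue_measure R).
Variables gamma beta : R.
Hypotheses (gamma_gt0 : 0 < gamma) (beta_gt0 : 0 < beta).

Let p := gamma + 2^-1.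
Let q := beta + 2^-1.
Let a (s : R) := s * p - 2^-1.
Let b (s : R) := s * q - 2^-1.
(* The integral of f^s converges if and only if s exceeds this threshold. *)
Definition renyi_threshold : R := Num.max (2^-1 / p) (2^-1 / q).
Local Notation u := renyi_threshold.
Let M k s : R := \int[mu]_x exp_moment (fun=> 1) (ln_skew_t gamma beta) k s x.

Let p_gt0 : 0 < p. Proof. by rewrite addr_gt0. Qed.
Let q_gt0 : 0 < q. Proof. by rewrite addr_gt0. Qed.

Lemma renyi_threshold_ltP s :
  0 < s * (gamma + 2^-1) - 2^-1 /\ 0 < s * (beta + 2^-1) - 2^-1 <-> u < s.
Proof.
rewrite /u gt_max !subr_gt0 !ltr_pdivrMr//.
by split => [[-> ->]//|/andP[]].
Qed.

(** At s = 1 the two Beta parameters are [gamma] and [beta], which are positive. Hence 1 is interior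
    to the domain of convergence, and the moments can be differentiated there. *)
Lemma renyi_threshold_lt1 : u < 1.
Proof. by apply/renyi_threshold_ltP; rewrite !mul1r !addrK. Qed.

Let u_lt1 : u < 1 := renyi_threshold_lt1.

(** Above the threshold, the logarithm of the integral of f^s; at s = 1 + r it is the cumulant
    generating function of ln f(X) at r, so its first two derivatives at 1 are a mean and a
    variance. Beta is split into Gamma factors so that these derivatives are digamma and trigamma
    values. *)
Definition ln_integral_skew_t (s : R) : R :=
  (s - 1) * (2 * ln 2 - ln (Num.sqrt (gamma + beta))) - s * ln (Beta gamma beta)
  + (ln (Gamma (a s)) + ln (Gamma (b s)) - ln (Gamma (a s + b s))).

Definition dln_integral_skew_t (s : R) : R :=
  2 * ln 2 - ln (Num.sqrt (gamma + beta)) - ln (Beta gamma beta)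
  + (p * digamma (a s) + q * digamma (b s) - (p + q) * digamma (a s + b s)).

Definition d2ln_integral_skew_t (s : R) : R :=
  p ^+ 2 * trigamma (a s) + q ^+ 2 * trigamma (b s)
  - (p + q) ^+ 2 * trigamma (a s + b s).

Local Notation L := ln_integral_skew_t.
Local Notation D := dln_integral_skew_t.
Local Notation D2 := d2ln_integral_skew_t.

Let ln_skew_t_mgf s : u < s ->
  (\int[mu]_x (expR (s * ln_skew_t gamma beta x))%:E = (expR (L s))%:E)%E.
Proof.
move=> /renyi_threshold_ltP[a0 b0]; rewrite integral_skew_t_powR//.
by rewrite /L -ln_Beta// [in RHS]expRD lnK// posrE Beta_gt0.
Qed.

Let measurable_ln_skew_t : measurable_fun setT (ln_skew_t gamma beta).
Proof. by apply: continuous_measurable_fun; exact: continuous_ln_skew_t. Qed.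

Let mgf_lty s t : u < s < t ->
  (\int[mu]_x (1 * expR (s * ln_skew_t gamma beta x))%:E < +oo)%E.
Proof.
by move=> /andP[us _]; under eq_integral do rewrite mul1r; rewrite ln_skew_t_mgf ?ltry.
Qed.

Let in_itv_succ s : u < s -> u < s < s + 1. Proof. by move=> ->; rewrite ltrDl/=. Qed.

Let measurable_one : measurable_fun [set: R] (fun=> 1 : R).
Proof. exact: measurable_cst. Qed.

Let one_ge0 (x : R) : 0 <= 1 :> R. Proof. exact: ler01. Qed.

Let is_derive_M k s : u < s -> is_derive s 1 (M k) (M k.+1 s).
Proof.
move=> us; apply: (@is_derive_exp_moment _ _ _ mu _ _ u (s + 1)).
- exact: measurable_one.
- exact: measurable_ln_skew_t.
- exact: one_ge0.
- by move=> t; exact: mgf_lty.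
- exact: in_itv_succ.
Qed.

Let integrable_M k s : u < s ->
  mu.-integrable setT (EFin \o exp_moment (fun=> 1) (ln_skew_t gamma beta) k s).
Proof.
move=> us; apply: (@integrable_exp_moment _ _ _ mu _ _ u (s + 1)).
- exact: measurable_one.
- exact: measurable_ln_skew_t.
- exact: one_ge0.
- by move=> t; exact: mgf_lty.
- exact: in_itv_succ.
Qed.

Let M0E s : u < s -> M 0 s = expR (L s).
Proof.
move=> us; rewrite /M /Rintegral /exp_moment.
by under eq_integral do rewrite expr0 !mul1r; rewrite ln_skew_t_mgf.
Qed.

Let is_derive_affine (r s : R) : is_derive s 1 (fun s : R => s * r - 2^-1) r.
Proof. by apply: is_derive_eq; rewrite /GRing.scale/=; ring. Qed.

Let is_derive_ab (s : R) : is_derive s 1 (fun s => a s + b s) (p + q).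
Proof.
have da : is_derive s 1 a p := is_derive_affine p s.
have db : is_derive s 1 b q := is_derive_affine q s.
exact: is_derive_eq.
Qed.

Lemma is_derive_ln_integral_skew_t s : u < s -> is_derive s 1 L (D s).
Proof.
move=> /renyi_threshold_ltP[a0' b0'].
have a0 : 0 < a s := a0'; have b0 : 0 < b s := b0'.
have d1 : is_derive s 1 (fun s => ln (Gamma (a s))) (digamma (a s) * p) :=
  is_derive1_comp (is_derive_ln_Gamma a0) (is_derive_affine p s).
have d2 : is_derive s 1 (fun s => ln (Gamma (b s))) (digamma (b s) * q) :=
  is_derive1_comp (is_derive_ln_Gamma b0) (is_derive_affine q s).
have d3 : is_derive s 1 (fun s => ln (Gamma (a s + b s))) (digamma (a s + b s) * (p + q)) :=
  @is_derive1_comp R _ (fun s => a s + b s) s _ _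
    (is_derive_ln_Gamma (addr_gt0 a0 b0)) (is_derive_ab s).
have d4 (k l : R) : is_derive s 1 (fun s : R => (s - 1) * k - s * l) (k - l).
  by apply: is_derive_eq; rewrite /GRing.scale/=; ring.
apply: (is_derive_eq (is_deriveD (d4 _ _) (is_deriveB (is_deriveD d1 d2) d3))).
rewrite /D; move: (digamma (a s)) (digamma (b s)) (digamma (a s + b s)) => *; ring.
Qed.

Lemma is_derive_dln_integral_skew_t s : u < s -> is_derive s 1 D (D2 s).
Proof.
move=> /renyi_threshold_ltP[a0' b0'].
have a0 : 0 < a s := a0'; have b0 : 0 < b s := b0'.
have d1 : is_derive s 1 (fun s => p * digamma (a s)) (p * (trigamma (a s) * p)).
  have d : is_derive s 1 (fun s => digamma (a s)) (trigamma (a s) * p) :=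
    is_derive1_comp (is_derive_digamma a0) (is_derive_affine p s).
  exact: is_derive_eq.
have d2 : is_derive s 1 (fun s => q * digamma (b s)) (q * (trigamma (b s) * q)).
  have d : is_derive s 1 (fun s => digamma (b s)) (trigamma (b s) * q) :=
    is_derive1_comp (is_derive_digamma b0) (is_derive_affine q s).
  exact: is_derive_eq.
have d3 : is_derive s 1 (fun s => (p + q) * digamma (a s + b s))
    ((p + q) * (trigamma (a s + b s) * (p + q))).
  have d : is_derive s 1 (fun s => digamma (a s + b s)) (trigamma (a s + b s) * (p + q)) :=
    @is_derive1_comp R _ (fun s => a s + b s) s _ _
      (is_derive_digamma (addr_gt0 a0 b0)) (is_derive_ab s).
  exact: is_derive_eq.
apply: (is_derive_eq (is_deriveD (is_derive_cst _ _ _) (is_deriveB (is_deriveD d1 d2) d3))).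
rewrite /D2; move: (trigamma (a s)) (trigamma (b s)) (trigamma (a s + b s)) => *; ring.
Qed.

Lemma ln_integral_skew_t1 : L 1 = 0.
Proof.
have a1 : a 1 = gamma by rewrite /a /p mul1r addrK.
have b1 : b 1 = beta by rewrite /b /q mul1r addrK.
rewrite /L a1 b1 (ln_Beta gamma_gt0 beta_gt0).
by rewrite subrr mul0r mul1r sub0r addNr.
Qed.

Lemma near_renyi_threshold : \forall s \near (1 : R), u < s.
Proof. exact: lt_nbhsr u_lt1. Qed.

(** [M 0] and exp L agree near s, which lies strictly above the threshold; their derivatives are
    computed under the integral sign and by the chain rule respectively. *)
Let M1E s : u < s -> M 1 s = expR (L s) * D s.
Proof.
move=> us; have dL := is_derive_ln_integral_skew_t us.
have dE := @is_derive1_comp R expR L s _ _ (is_derive_expR (L s)) dL.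
have dM := is_derive_M 0 us.
have nM : {near s, M 0 =1 expR \o L}.
  by apply: filterS (lt_nbhsr us) => t ut; rewrite M0E.
have := near_eq_derive (1 : R) nM.
by rewrite !derive_val.
Qed.

(** The same comparison one order higher, starting from [M1E], at the point 1 where exp L = 1. *)
Let M2E : M 2 1 = D 1 ^+ 2 + D2 1.
Proof.
have dL := is_derive_ln_integral_skew_t u_lt1.
have dE := @is_derive1_comp R expR L 1 _ _ (is_derive_expR (L 1)) dL.
have dD := is_derive_dln_integral_skew_t u_lt1.
have dM := is_derive_M 1 u_lt1.
have nM : {near (1 : R), M 1 =1 (expR \o L) \* D}.
  by apply: filterS near_renyi_threshold => t ut; rewrite M1E.
have := near_eq_derive (1 : R) nM.
rewrite !derive_val => ->.
by rewrite /GRing.scale/= ln_integral_skew_t1 expR0; ring.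
Qed.

Lemma integral_skew_t_powR_lt s : u < s ->
  (\int[mu]_x (skew_t gamma beta x `^ s)%:E = (expR (L s))%:E)%E.
Proof.
move=> us; under eq_integral do rewrite skew_t_powR//.
exact: ln_skew_t_mgf.
Qed.

Lemma integral_skew_t_ln :
  mu.-integrable setT (fun x => (skew_t gamma beta x * ln (skew_t gamma beta x))%:E) /\
  (\int[mu]_x (skew_t gamma beta x * ln (skew_t gamma beta x))%:E = (D 1)%:E)%E.
Proof.
have E : (fun x => (skew_t gamma beta x * ln (skew_t gamma beta x))%:E) =
    EFin \o exp_moment (fun=> 1) (ln_skew_t gamma beta) 1 1.
  apply/funext => x /=; rewrite ln_skew_tE// skew_tE// /exp_moment.
  by rewrite expr1 !mul1r mulrC.
rewrite E; split; first exact: integrable_M.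
have -> : D 1 = M 1 1 by rewrite M1E// ln_integral_skew_t1 expR0 mul1r.
by rewrite /M /Rintegral fineK//; apply: integrable_fin_num => //; exact: integrable_M.
Qed.

(** Expanding the square gives M 2 - 2 D M 1 + D^2 M 0 at 1; the values D^2 + D2, D and 1 of these
    moments leave D2. *)
Lemma integral_skew_t_ln_variance :
  (\int[mu]_x (((ln (skew_t gamma beta x) - D 1) ^+ 2)%:E * (skew_t gamma beta x)%:E) =
   (D2 1)%:E)%E.
Proof.
pose m k := exp_moment (fun=> 1) (ln_skew_t gamma beta) k 1.
have E x : (((ln (skew_t gamma beta x) - D 1) ^+ 2)%:E * (skew_t gamma beta x)%:E =
    (m 2%N x + (- 2 * D 1 * m 1%N x + D 1 ^+ 2 * m 0%N x))%:E)%E.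
  rewrite -EFinM ln_skew_tE// skew_tE// /m /exp_moment !mul1r.
  by congr EFin; ring.
under eq_integral do rewrite E.
have i k : mu.-integrable setT (fun x => (m k x)%:E) := integrable_M k u_lt1.
have IM k : (\int[mu]_x (m k x)%:E = (M k 1)%:E)%E.
  by rewrite /M /Rintegral fineK//; apply: integrable_fin_num => //; exact: i.
have M1 : M 1 1 = D 1 by rewrite M1E// ln_integral_skew_t1 expR0 mul1r.
have M0 : M 0 1 = 1 by rewrite M0E// ln_integral_skew_t1 expR0.
have M2 := M2E.
clearbody m; clear E.
move: (M 0 1) (M 1 1) (M 2 1) (D 1) (D2 1) (IM 0%N) (IM 1%N) (IM 2%N) M0 M1 M2.
move=> M0 M1 M2 d d2 I0 I1 I2 M0E' M1E' M2E'.
have i1 := integrableZl measurableT (- 2 * d) (i 1%N).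
have i0 := integrableZl measurableT (d ^+ 2) (i 0%N).
transitivity (\int[mu]_x ((m 2%N x)%:E + ((- 2 * d)%:E * (m 1%N x)%:E + (d ^+ 2)%:E * (m 0%N x)%:E)))%E.
  by apply: eq_integral.
rewrite integralD//=; last exact: integrableD.
rewrite integralD//= !integralZl// I0 I1 I2 -!EFinM -!EFinD M0E' M1E' M2E'.
by congr EFin; ring.
Qed.

End skew_t_moments.

(* Without this, unification unfolds these down to the Lebesgue integral. *)
Local Opaque Gamma Beta digamma trigamma.

(** * Rényi information, Shannon entropy and Song measure of the skew t density *)

Section renyi_skew_t.
Context {R : realType}.
Notation mu := (@lebesgue_measure R).
Variables gamma beta : R.
Hypotheses (gamma_gt0 : 0 < gamma) (beta_gt0 : 0 < beta).

Local Notation f := (skew_t gamma beta).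
Local Notation L := (ln_integral_skew_t gamma beta).
Local Notation D := (dln_integral_skew_t gamma beta).
Local Notation D2 := (d2ln_integral_skew_t gamma beta).
Local Notation u := (renyi_threshold gamma beta).

Lemma measurable_skew_t : measurable_fun setT f.
Proof.
have -> : f = (fun x => expR (1 * ln_skew_t gamma beta x)).
  by apply/funext => x; rewrite mul1r skew_tE.
by apply: continuous_measurable_fun; exact: continuous_expR_ln_skew_t.
Qed.

Lemma prob_density_skew_t : prob_density f.
Proof.
split; first exact: measurable_skew_t.
  by move=> x; rewrite ltW// skew_t_gt0.
have -> : 1%E = (expR (L 1))%:E by rewrite ln_integral_skew_t1// expR0.
rewrite -(integral_skew_t_powR_lt gamma_gt0 beta_gt0 (renyi_threshold_lt1 gamma_gt0 beta_gt0)).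
by apply: eq_integral => x _; rewrite powRr1// ltW// skew_t_gt0.
Qed.

Lemma renyi_skew_t s : u < s -> s != 1 -> renyi s f = ((1 - s)^-1 * L s)%:E.
Proof.
move=> us s1; rewrite /renyi (negbTE s1) integral_skew_t_powR_lt//.
by rewrite lne_EFin ?expR_gt0// expRK -EFinM.
Qed.

Lemma shannon_skew_t : renyi 1 f = (- D 1)%:E.
Proof.
have [_ E] := integral_skew_t_ln gamma_gt0 beta_gt0.
by rewrite /renyi eqxx /shannon E.
Qed.

(* At 1 the Renyi information is a difference quotient of L, so its derivative
   there is the second-order coefficient of L. *)
Lemma is_derive_renyi_skew_t : is_derive (1 : R) 1 (renyi_fin f) (- (D2 1 / 2)).
Proof.
have nL : \forall x \near (1 : R), is_derive (x : R) (1 : R) L (D x).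
  apply: filterS (near_renyi_threshold gamma_gt0 beta_gt0) => x ux.
  exact: is_derive_ln_integral_skew_t.
have dD : is_derive (1 : R) 1 D (D2 1).
  by apply: is_derive_dln_integral_skew_t => //; exact: renyi_threshold_lt1.
have h2 : h^-1 *: (renyi_fin f (h *: 1 + 1) - renyi_fin f 1) @[h --> (0 : R)^'] --> - (D2 1 / 2).
  have H := cvg_second_order nL dD.
  apply: cvg_trans (cvgN H); apply: near_eq_cvg.
  have ns : \forall h \near (0 : R)^', u < h + 1.
    apply: nbhs_dnbhs; near=> h.
    rewrite -ltrBlDr; near: h; apply: lt_nbhsr.
    by rewrite subr_lt0 renyi_threshold_lt1.
  near=> h; have h0 : h != 0 by near: h; exact: nbhs_dnbhs_neq.
  have uh : u < h + 1 by near: h.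
  rewrite /renyi_fin /GRing.scale/= mulr1 shannon_skew_t renyi_skew_t//; last first.
    by rewrite -subr_eq0 addrK.
  rewrite /= ln_integral_skew_t1//.
  (* The Rényi information is - L(h + 1) / h at h + 1 and - D 1 at 1, so its difference quotient is
     the opposite of the second-order quotient of L at 1; the 0 stands for L 1. *)
  rewrite -[LHS]/(- ((L (h + 1) - 0 - D 1 * h) / h ^+ 2)).
  have -> : 1 - (h + 1) = - h by ring.
  by field; rewrite ?oppr_eq0 h0.
have dR : derivable (renyi_fin f) 1 1 by apply/cvg_ex; exists (- (D2 1 / 2)).
by apply: DeriveDef => //; exact: cvg_lim h2.
Unshelve. all: by end_near. Qed.

Lemma song_skew_t : song f = D2 1.
Proof.
have dR := is_derive_renyi_skew_t.
by rewrite /song derive1E derive_val; field.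
Qed.

(** Derivability of [renyi_fin] at 1 gives its continuity there, and the closed form makes the
    extended real values finite near 1, so the limit lifts from the reals. *)
Lemma cvg_renyi_skew_t : renyi s f @[s --> (1 : R)^'] --> renyi 1 f.
Proof.
have -> : renyi 1 f = (renyi_fin f 1)%:E by rewrite /renyi_fin shannon_skew_t.
apply: cvg_EFin.
  have := near_renyi_threshold gamma_gt0 beta_gt0 => nu.
  near=> s; rewrite renyi_skew_t//.
    by near: s; exact: nbhs_dnbhs nu.
  by near: s; exact: nbhs_dnbhs_neq.
have cR : {for (1 : R), continuous (renyi_fin f)}.
  by apply/differentiable_continuous/derivable1_diffP; case: is_derive_renyi_skew_t.
exact: cvg_within_filter cR.
Unshelve. all: by end_near. Qed.

(** Expectations pass from [P] to the law of [X] and then to Lebesgue measure weighted by the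
    density. For the mean, integrability of f ln f is carried along; the squared deviation is
    nonnegative and passes directly. *)
Lemma variance_ln_skew_t d (T : measurableType d) (P : probability T R)
    (X : {RV P >-> R}) : has_density X f ->
  'V_P[fun w => ln (f (X w))]%E = (D2 1)%:E.
Proof.
move=> Xf; have f0 x : 0 <= f x by rewrite ltW// skew_t_gt0.
have mln : measurable_fun setT (fun x => ln (f x)).
  by apply: measurableT_comp => //; exact: measurable_skew_t.
have [i E] := integral_skew_t_ln gamma_gt0 beta_gt0.
(* [lebesgue_measure] lives on [measurableTypeR R], whose measurable structure is
   not convertible to the one of [R] in [has_density], though its sets are. *)
have mX : measurable_fun setT (X : T -> measurableTypeR R) := measurable_funP X.
pose X' : {RV P >-> measurableTypeR R} := HB.pack (X : T -> measurableTypeR R)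
  (isMeasurableFun.Build _ _ _ (measurableTypeR R) (X : T -> measurableTypeR R) mX).
have ifln : mu.-integrable setT (fun x => (ln (f x) * f x)%:E).
  by under eq_fun do rewrite mulrC.
have [iX EX] := @integral_density _ (measurableTypeR R) R (distribution P X') mu f
  measurable_skew_t f0 Xf _ mln ifln.
pose h (x : measurableTypeR R) := (ln (f x))%:E.
have mh : measurable_fun setT h by exact/measurable_EFinP.
have EY : 'E_P[fun w => ln (f (X w))]%E = (D 1)%:E.
  rewrite unlock -E.
  under [RHS]eq_integral do rewrite mulrC.
  rewrite -EX; apply/esym/(@integral_distribution _ _ _ (measurableTypeR R) _ P X' h mh).
  apply/integrableP; split.
    by apply/measurable_EFinP; exact: (measurableT_comp mln mX).
  have /integrableP[_] := iX.
  have mah : measurable_fun setT (abse \o h) by exact: measurableT_comp.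
  have ah0 y : (0 <= (abse \o h) y)%E by exact: abse_ge0.
  by have <- := @ge0_integral_distribution _ _ _ (measurableTypeR R) _ P X' (abse \o h) mah ah0.
rewrite /variance covariance.unlock EY expectation.unlock.
rewrite -integral_skew_t_ln_variance//.
pose g (x : measurableTypeR R) := ((ln (f x) - D 1) ^+ 2)%:E.
have mg : measurable_fun setT g.
  by apply/measurable_EFinP; apply: measurable_funX; exact: measurable_funB.
have g0 x : (0 <= g x)%E by rewrite lee_fin sqr_ge0.
have := @ge0_integral_density _ (measurableTypeR R) R (distribution P X') mu f
  measurable_skew_t Xf g mg g0.
by move=> <-; rewrite (@ge0_integral_distribution _ _ _ (measurableTypeR R) _ P X' g mg g0).
Qed.

End renyi_skew_t.

Unset Implicit Arguments.

Theorem theorem6p1 (R : realType) (gamma beta : R)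
    (gamma_gt0 : 0 < gamma) (beta_gt0 : 0 < beta) :
  let f := skew_t gamma beta in
  [/\ prob_density f,
      forall alpha : R, 0 < alpha -> alpha != 1 ->
        0 < alpha * (gamma + 2^-1) - 2^-1 ->
        0 < alpha * (beta + 2^-1) - 2^-1 ->
        renyi alpha f =
          ((1 - alpha)^-1 *
           ln (4 `^ (alpha - 1)
               * Beta (alpha * (gamma + 2^-1) - 2^-1)
                      (alpha * (beta + 2^-1) - 2^-1)
               / (Num.sqrt (beta + gamma) `^ (alpha - 1)
                  * Beta gamma beta `^ alpha)))%:E,
      (renyi alpha f @[alpha --> (1 : R)^'] --> renyi 1 f) /\
      renyi 1 f =
        (- ln (4 / (Num.sqrt (gamma + beta) * Beta gamma beta))
         - (beta + 2^-1) * digamma beta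
         - (gamma + 2^-1) * digamma gamma
         + (beta + gamma + 1) * digamma (beta + gamma))%:E &
      [/\ derivable (renyi_fin f) 1 1,
          song f =
            (beta + 2^-1) ^+ 2 * trigamma beta
            + (gamma + 2^-1) ^+ 2 * trigamma gamma
            - (beta + gamma + 1) ^+ 2 * trigamma (beta + gamma) &
          forall (d : measure_display) (T : measurableType d)
            (P : probability T R) (X : {RV P >-> R}),
            has_density X f ->
            'V_P[fun w => ln (f (X w))]%E = (song f)%:E]].
Proof.
have s0 : 0 < Num.sqrt (gamma + beta) by rewrite sqrtr_gt0 addr_gt0.
have B0 := Beta_gt0 gamma_gt0 beta_gt0.
have ln4 : ln (4 : R) = 2 * ln 2.
  by rewrite (_ : 4 = 2 ^+ 2) ?lnXn ?mulr_natl// -natrX.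
have ag : 1 * (gamma + 2^-1) - 2^-1 = gamma by rewrite mul1r addrK.
have bb : 1 * (beta + 2^-1) - 2^-1 = beta by rewrite mul1r addrK.
have pq : gamma + 2^-1 + (beta + 2^-1) = beta + gamma + 1.
  by field.
split.
- exact: prob_density_skew_t.
- move=> alpha _ alpha1 a0 b0.
  rewrite renyi_skew_t//; last by apply/renyi_threshold_ltP.
  congr (_ * _)%:E.
  have Bab0 := Beta_gt0 a0 b0.
  have n4 : 0 < (4 : R) `^ (alpha - 1) by exact: powR_gt0.
  have ns : 0 < Num.sqrt (gamma + beta) `^ (alpha - 1) by exact: powR_gt0.
  have nB : 0 < Beta gamma beta `^ alpha by exact: powR_gt0.
  (* The logarithm splits over the positive factors of the closed form into the terms of
     [ln_integral_skew_t]. *)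
  rewrite (addrC beta gamma) ln_div ?posrE; [|exact: mulr_gt0|exact: mulr_gt0].
  rewrite (lnM n4 Bab0) (lnM ns nB) !ln_powR ln4 (ln_Beta a0 b0).
  rewrite /ln_integral_skew_t.
  have E (l x1 x2 x3 x4 x5 : R) :
      (alpha - 1) * (2 * l - x5) - alpha * x4 + (x1 + x2 - x3) =
      (alpha - 1) * (2 * l) + (x1 + x2 - x3) - ((alpha - 1) * x5 + alpha * x4).
    by ring.
  exact: E.
- split; first exact: cvg_renyi_skew_t.
  rewrite (shannon_skew_t gamma_gt0 beta_gt0) /dln_integral_skew_t ag bb pq (addrC gamma beta).
  have s0' : 0 < Num.sqrt (beta + gamma) by rewrite addrC.
  have h4 : (4 : R) \is Num.pos by rewrite posrE.
  rewrite (ln_div h4 (mulr_gt0 s0' B0)) (lnM s0' B0) ln4; congr EFin.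
  move: (digamma gamma) (digamma beta) (digamma (beta + gamma))
    (ln (Beta gamma beta)) (ln (Num.sqrt (beta + gamma))) => x1 x2 x3 x4 x5.
  ring.
- split.
  + by case: (is_derive_renyi_skew_t gamma_gt0 beta_gt0).
  + rewrite (song_skew_t gamma_gt0 beta_gt0) /d2ln_integral_skew_t ag bb pq (addrC gamma beta).
    have E (x y z : R) : x + y - z = y + x - z by rewrite (addrC x).
    exact: E.
  + by move=> d T P X Xf; rewrite (song_skew_t gamma_gt0 beta_gt0); exact: variance_ln_skew_t.
Qed.
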